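(* Let $k\ge 1$ be an integer. The map $\delta$ that sends $M\in\{M \in \mathsf{AMS}_{3k-1} : |M| = 2k-1\}$ to the lattice path $\pi_1\cdots\pi_{3k-1}$ starting at $(0,0)$ whose $i$th step $\pi_i$ is north if $i\in M$ and east otherwise is a bijection from $\{M \in \mathsf{AMS}_{3k-1} : |M| = 2k-1\}$ to the set of $(2k-1,k)$-Dyck paths.
   Context: For a positive integer $n$, write $[n]=\{1,\dots,n\}$. A Stirling permutation of order $n$ is a word $w = w(1)w(2)\cdots w(2n)$ consisting of the multiset of letters $\{1,1,\ldots,n,n\}$ (each value of $[n]$ appears exactly twice), such that for each $1\le k\le n$, all of the values appearing between the two copies of $k$ in $w$ are larger than $k$. $Q_n$ denotes the set of Stirling permutations of order $n$. For $w\in Q_n$, if there is an index $i\in\{2,\ldots,2n-2\}$ such that $w(i-1)<w(i)=w(i+1)>w(i+2)$, then the value $w(i)$ is called a mesa of $w$. $\mathrm{Mesa}(w)\subseteq[n]$ denotes the set of all mesas of $w$. $\mathsf{AMS}_n=\{\mathrm{Mesa}(w): w\in Q_n\}$ is the set of admissible mesa sets for Stirling permutations of order $n$. For coprime positive integers $m,n$, an $(m,n)$-Dyck path is a lattice path consisting of unit north steps $(0,1)$ and unit east steps $(1,0)$ from $(0,0)$ to $(n,m)$ that remains below the line $y=\frac{m}{n}x$ (the two endpoints lie on the line; every other lattice point of the path lies below it). *)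

(* Defs.v *)
From mathcomp Require Import all_boot all_order all_algebra finmap.
From mathcomp Require Import boolp classical_sets functions.

Set Implicit Arguments.
Unset Strict Implicit.
Unset Printing Implicit Defensive.

Import Order.TTheory GRing.Theory Num.Theory.

Local Open Scope classical_set_scope.
Local Open Scope nat_scope.

(* Words have letters in {1, ..., n}; their positions are numbered from 0. *)

(* In a word containing every letter exactly twice, [nth 0 w i = nth 0 w l]
   with [i < l] says that i and l are the positions of the two copies. *)
Definition StirlingPerm (n : nat) : set (seq nat) :=
  [set w | perm_eq w (iota 1 n ++ iota 1 n) /\
           forall i j l : nat, i < j -> j < l -> l < size w ->
             nth 0 w i = nth 0 w l -> nth 0 w i < nth 0 w j].

(* For [size w = n.*2], the bounds [0 < i] and [i.+2 < size w] are the bounds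
   {2, ..., 2n - 2} on the position [i.+1] counted from 1. *)
Definition mesa_at (w : seq nat) (i : nat) : bool :=
  [&& 0 < i, i.+2 < size w,
      nth 0 w i.-1 < nth 0 w i, nth 0 w i == nth 0 w i.+1
    & nth 0 w i.+2 < nth 0 w i.+1].

Definition Mesa (w : seq nat) : {fset nat} :=
  [fset v in [seq nth 0 w i | i <- iota 0 (size w) & mesa_at w i]]%fset.

Definition AMS (n : nat) : set {fset nat} := [set Mesa w | w in StirlingPerm n].

Inductive step := North | East.

Definition move (p : nat * nat) (s : step) : nat * nat :=
  match s with North => (p.1, p.2.+1) | East => (p.1.+1, p.2) end.

(* A lattice path from (0, 0) is given by the sequence of its steps. *)
Definition endpoint (pi : seq step) : nat * nat := foldl move (0, 0) pi.

Definition DyckPath (m n : nat) : set (seq step) :=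
  [set pi | endpoint pi = (n, m) /\
            forall i : nat, 0 < i -> i < size pi ->
              let: (x, y) := endpoint (take i pi) in
              (y%:Q < m%:Q / n%:Q * x%:Q)%R].

Definition delta (n : nat) (M : {fset nat}) : seq step :=
  [seq if i \in M then North else East | i <- iota 1 n].

(* Main.v *)
Require Import Defs.
From mathcomp Require Import all_boot all_order all_algebra finmap.
From mathcomp Require Import boolp classical_sets functions.
From mathcomp Require Import zify.

(** The theorem rests on a description of all admissible mesa sets: [M] is in
    [AMS n] iff it is contained in {1, ..., n} and
    [3 * #|M :&: {1, ..., i}| < 2 * i] for every [i] in {1, ..., n} ([AMSP]).

    The inequality is necessary because two mesas are never close.  If a mesa
    occupies the positions [s] and [s + 1], no other mesa starts at [s + 1] or
    [s + 2], so the zones {s, s + 1, s + 2} of distinct mesas are disjoint.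
    When the letter of the mesa is at most [i], so are the letters at the three
    positions of its zone and at the position before it.  The zones of the
    mesas at most [i] hence lie among the [2 * i] positions of letters at most
    [i], and miss the first of these ([Mesa_count_lt]).

    The inequality is sufficient by induction on [n], inserting two adjacent
    copies of [n + 1] in front of some position [p] of a Stirling permutation
    [w] of order [n].  The new letter becomes a mesa iff the insertion is
    strictly inside the word, and the old mesas survive iff [p] is in no zone
    ([Mesa_insert2]).  If [n + 1] must not be a mesa, it goes at the end; if it
    must be one, the inequality at [n + 1] says exactly that the zones, with
    three positions each, do not fill the [2 * n - 1] inner positions
    ([Stirling_of_count]).

    It remains to see that the same inequality describes Dyck paths.  After [i]
    steps, [y] of them north, the path is below the line iff
    [k * y < (2 * k - 1) * (i - y)], that is, iff
    [(3 * k - 1) * y < (2 * k - 1) * i].  The slope [(2 * k - 1) / (3 * k - 1)]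
    is so close to [2 / 3] that for [0 < i < 3 * k - 1] this amounts to
    [3 * y < 2 * i], and at the endpoint [3 * y < 2 * i] holds automatically
    ([DyckPath_countP]). *)

Set Implicit Arguments.
Unset Strict Implicit.
Unset Printing Implicit Defensive.

Import GRing.Theory Num.Theory.

Local Open Scope nat_scope.

(** * Positions of mesas *)

Definition mesa_pos (w : seq nat) : seq nat :=
  [seq i <- iota 0 (size w) | mesa_at w i].

Lemma mem_mesa_pos w i : (i \in mesa_pos w) = mesa_at w i.
Proof.
rewrite mem_filter mem_iota add0n /=.
by case Hm: (mesa_at w i) => //=; case/and5P: Hm => *; lia.
Qed.

Lemma MesaP w v :
  reflect (exists2 i, mesa_at w i & nth 0 w i = v) (v \in Mesa w).
Proof.
rewrite in_fset /=; apply: (iffP mapP) => [[i] | [i Hi <-]].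
  by rewrite mem_mesa_pos => Hi ->; exists i.
by exists i; rewrite ?mem_mesa_pos.
Qed.

(** The case [j = i + 1] would make the letter after the mesa at [i] equal to
    it; the case [j = i + 2] would require an ascent from [i + 1] to [i + 2],
    where the mesa at [i] has a descent. *)
Lemma mesa_at_gap w i j : mesa_at w i -> mesa_at w j -> i < j -> i.+2 < j.
Proof.
case/and5P => i0 isz i1 /eqP i2 i3 /and5P[j0 jsz j1 /eqP j2 j3] ij.
rewrite ltn_neqAle; apply/andP; split.
  by apply/eqP => E; move: j1; rewrite -E /=; lia.
rewrite ltn_neqAle ij andbT; apply/eqP => E.
by move: j2; rewrite -E; lia.
Qed.

(** Besides the two positions of the mesa, a zone contains the next one: the
    gaps in front of these three positions are those where an insertion
    destroys the mesa. *)
Definition mesa_zone (S : seq nat) : seq nat :=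
  S ++ map succn S ++ map (addn 2) S.

Lemma mem_mesa_zone S p :
  (p \in mesa_zone S) = [|| p \in S, (0 < p) && (p.-1 \in S)
                          | (1 < p) && (p.-2 \in S)].
Proof.
rewrite !mem_cat; congr [|| _, _ | _]; case: p => [|[|p]] //=.
- by apply/mapP => -[].
- by rewrite (mem_map succn_inj).
- by rewrite (mem_map succn_inj).
- by apply/mapP => -[].
- by apply/mapP => -[].
- by rewrite -[p.+2]/(2 + p) (mem_map (@addnI 2)).
Qed.

Lemma size_mesa_zone S : size (mesa_zone S) = 3 * size S.
Proof. by rewrite !size_cat !size_map; lia. Qed.

Lemma mesa_zone_uniq w S :
  uniq S -> {subset S <= mesa_at w} -> uniq (mesa_zone S).
Proof.
move=> US HS.
have gap (i j : nat) : i \in S -> j \in S -> i < j -> i.+2 < j.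
  by move=> /HS Hi /HS Hj; apply: mesa_at_gap Hi Hj.
rewrite !cat_uniq US !map_inj_uniq ?US //=; try exact: addnI; try exact: succn_inj.
rewrite andbT; apply/andP; split; apply/hasPn => q.
- rewrite mem_cat => /orP[] /mapP[i iS ->] /=; apply/negP => jS.
    by have := gap _ _ iS jS; lia.
  by have := gap _ _ iS jS; lia.
- move=> /mapP[i iS ->] /=; apply/mapP => -[j jS E].
  by have := gap _ _ iS jS; lia.
Qed.

Lemma iota1S n : iota 1 n.+1 = iota 1 n ++ [:: n.+1].
Proof. by rewrite -[in LHS](addn1 n) iotaD. Qed.

(** * Counting mesas among the small letters *)

Section Stirling.
Variables (n : nat) (w : seq nat).
Hypothesis Hw : StirlingPerm n w.

Lemma Stirling_mem v : (v \in w) = (0 < v <= n).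
Proof.
case: Hw => /perm_mem -> _.
by rewrite mem_cat orbb mem_iota add1n ltnS.
Qed.

Lemma Stirling_nth i : i < size w -> 0 < nth 0 w i <= n.
Proof. by move=> Hi; rewrite -Stirling_mem mem_nth. Qed.

Lemma Stirling_count_le i : i <= n -> count (leq^~ i) w = i.*2.
Proof.
case: Hw => /permP -> _ Hi; rewrite count_cat addnn; congr _.*2.
rewrite -(subnKC Hi) iotaD count_cat.
rewrite (@eq_in_count _ _ predT) ?count_predT ?size_iota; last first.
  by move=> v; rewrite mem_iota /=; lia.
rewrite (@eq_in_count _ _ pred0) ?count_pred0 ?addn0 //.
by move=> v; rewrite mem_iota /=; lia.
Qed.

Lemma Stirling_size : size w = n.*2.
Proof. by case: Hw => /perm_size -> _; rewrite size_cat size_iota addnn. Qed.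

Lemma Stirling_between i j l : i < j -> j < l -> l < size w ->
  nth 0 w i = nth 0 w l -> nth 0 w i < nth 0 w j.
Proof. by case: Hw => _; apply. Qed.

(** If two mesas had the same letter, the second copy in the first mesa would lie
    between two equal letters without being larger. *)
Lemma mesa_at_inj : {in mesa_at w &, injective (nth 0 w)}.
Proof.
move=> i j Hi Hj E.
wlog ij : i j Hi Hj E / i < j.
  move=> W; case: (ltngtP i j) => // ij; first exact: W.
  by symmetry; apply: W.
have g := mesa_at_gap Hi Hj ij.
have : nth 0 w i < nth 0 w i.+1.
  apply: (@Stirling_between i i.+1 j) => //; first exact: ltnW.
  by case/and5P: Hj => _ jsz _ _ _; lia.
by case/and5P: Hi => _ _ _ /eqP <- _; rewrite ltnn.
Qed.

(** Turns the count of letters that appears in the admissibility condition into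
    a count of positions, where the zones live. *)
Lemma count_Mesa i : i <= n ->
  count (mem (Mesa w)) (iota 1 i) = count (fun s => nth 0 w s <= i) (mesa_pos w).
Proof.
move=> Hi; rewrite -!size_filter -[RHS](size_map (nth 0 w)).
apply/perm_size/uniq_perm.
- by rewrite filter_uniq ?iota_uniq.
- rewrite map_inj_in_uniq ?filter_uniq ?iota_uniq // => s t.
  rewrite !mem_filter => /andP[_ /andP[Hs _]] /andP[_ /andP[Ht _]].
  exact: mesa_at_inj.
move=> v; rewrite mem_filter mem_iota; apply/andP/mapP.
  move=> [/MesaP[s Hs <-] Hv]; exists s => //.
  by rewrite mem_filter mem_mesa_pos Hs andbT; lia.
move=> [s]; rewrite mem_filter mem_mesa_pos => /andP[Hv Hs] ->; split.
  by apply/MesaP; exists s.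
have := @Stirling_nth s; case/and5P: Hs => *; lia.
Qed.

Lemma Mesa_count_lt i : 0 < i <= n ->
  3 * count (mem (Mesa w)) (iota 1 i) < 2 * i.
Proof.
move=> /andP[i0 Hi]; rewrite count_Mesa // -size_filter.
set S := filter _ _; rewrite -size_mesa_zone mul2n -(Stirling_count_le Hi).
have HS (s : nat) : s \in S -> mesa_at w s /\ nth 0 w s <= i.
  by rewrite mem_filter mem_mesa_pos => /andP[].
(* [f] is in no zone, as the position before any position of a zone also carries
   a letter at most [i]. *)
pose f := find (leq^~ i) w.
have hasf : has (leq^~ i) w.
  by rewrite has_count Stirling_count_le //; lia.
have fle : nth 0 w f <= i := nth_find 0 hasf.
have fmin j : j < f -> i < nth 0 w j.
  by move=> /(before_find 0); rewrite leqNgt => /negbFE.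
have zone_le (p : nat) : p \in mesa_zone S ->
    [/\ p < size w, nth 0 w p <= i, 0 < p & nth 0 w p.-1 <= i].
  rewrite mem_mesa_zone => /or3P[/HS|/andP[p0 /HS]|/andP[p0 /HS]] [].
  - case/and5P=> a b c /eqP d e g; split=> //=; lia.
  - case: p p0 => // p _ /and5P[/= a b c /eqP/= d /= e] /= g; split=> //=; lia.
  - case: p p0 => [|[|p]] // _ /and5P[/= a b c /eqP/= d /= e] /= g; split=> //=; lia.
have -> : count (leq^~ i) w = size [seq p <- iota 0 (size w) | nth 0 w p <= i].
  rewrite size_filter -[in LHS](mkseq_nth 0 w) count_map; exact: eq_count.
rewrite -[X in X <= _]/(size (f :: mesa_zone S)); apply: uniq_leq_size.
  rewrite /= (@mesa_zone_uniq w) ?filter_uniq ?iota_uniq ?andbT //; last first.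
    by move=> s /HS[].
  apply/negP => /zone_le [_ _ f0 H].
  by have := fmin f.-1; lia.
move=> p; rewrite inE mem_filter mem_iota add0n /= => /orP[/eqP ->|].
  by rewrite fle -has_find.
by move=> /zone_le [-> -> _ _].
Qed.

End Stirling.

(** * Inserting the two copies of the largest letter *)

Definition insert2 (p x : nat) (w : seq nat) : seq nat :=
  take p w ++ [:: x; x] ++ drop p w.

Section Insert.
Variables (n p : nat) (w : seq nat).
Hypothesis Hw : StirlingPerm n w.
Hypothesis Hp : p <= size w.
Let w' := insert2 p n.+1 w.

Lemma size_insert2 : size w' = (size w).+2.
Proof. by rewrite !size_cat /= addnCA -size_cat cat_take_drop. Qed.

Lemma nth_insert2 j :
  nth 0 w' j = if j < p then nth 0 w j
               else if j < p.+2 then n.+1 else nth 0 w (j - 2).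
Proof.
rewrite /w' /insert2 nth_cat size_takel //.
case: ltnP => jp; first by rewrite nth_take.
rewrite nth_cat /=; case: (ltnP j p.+2) => jp2.
  have -> : j - p < 2 by lia.
  by have [->|->] : j - p = 0 \/ j - p = 1 by lia.
have -> : (j - p < 2) = false by lia.
by rewrite nth_drop; congr nth; lia.
Qed.

(** No old pair of equal letters is violated, as the new letter is larger than
    all others; nothing lies between the two new letters. *)
Lemma Stirling_insert2 : StirlingPerm n.+1 w'.
Proof.
split.
  rewrite iota1S /w' /insert2.
  apply/permP => a; case: (Hw) => /permP/(_ a) + _.
  rewrite -[in X in X -> _](cat_take_drop p w) !count_cat /=; lia.
move=> i j l ij jl; rewrite size_insert2 => lsz.
have H := Stirling_between Hw; have B q := @Stirling_nth n w Hw q.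
rewrite !nth_insert2.
case: (ltnP i p) => ip.
  have Bi := B i; case: (ltnP l p) => lp.
    have -> : j < p by lia.
    by apply: H => //; lia.
  case: (ltnP l p.+2) => lp2; first by lia.
  case: (ltnP j p) => jp; first by apply: H; lia.
  by case: (ltnP j p.+2) => jp2; [lia | apply: H; lia].
have -> : (l < p) = false by lia.
have -> : (j < p) = false by lia.
have -> : (l < p.+2) = false by lia.
case: (ltnP i p.+2) => ip2; first by have := B (l - 2); lia.
have -> : (j < p.+2) = false by lia.
by apply: H; lia.
Qed.

Lemma mesa_at_insert2_lt i : i.+2 < p -> mesa_at w' i = mesa_at w i.
Proof.
move=> ip; rewrite /mesa_at size_insert2 !nth_insert2.
have [-> [-> [-> ->]]] : i < p /\ i.-1 < p /\ i.+1 < p /\ i.+2 < p by lia.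
by have [-> ->] : i.+2 < (size w).+2 /\ i.+2 < size w by lia.
Qed.

Lemma mesa_at_insert2_gt i : p < i -> mesa_at w' i.+2 = mesa_at w i.
Proof.
case: i => // i ip; rewrite /mesa_at size_insert2 !nth_insert2 /=.
have E q : p <= q -> (q.+2 < p) = false /\ (q.+2 < p.+2) = false.
  by split; lia.
rewrite !(fun q h => proj1 (E q h)) ?(fun q h => proj2 (E q h)); try lia.
by rewrite !ltnS !subn2.
Qed.

Lemma mesa_at_insert2_eq : mesa_at w' p = (0 < p < size w).
Proof.
rewrite /mesa_at size_insert2 !nth_insert2.
have B q := @Stirling_nth n w Hw q.
case: p Hp => [|q] //= Hq; have := B q; have := B q.+1.
have [-> -> -> ->] : [/\ q < q.+1, (q.+1 < q.+1) = false,
  (q.+2 < q.+1) = false & (q.+3 < q.+1) = false] by split; lia.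
have [-> -> ->] : [/\ q.+1 < q.+3, q.+2 < q.+3 & (q.+3 < q.+3) = false].
  by split; lia.
by rewrite subn2 eqxx /=; lia.
Qed.

(** A mesa meeting the new letters without being made of them would have one of
    these maximal letters as a neighbour, or as only one of its two copies. *)
Lemma mesa_at_insert2_inv j : mesa_at w' j ->
  [\/ j = p, j.+2 < p | p.+2 < j].
Proof.
rewrite /mesa_at size_insert2 !nth_insert2.
have B q := @Stirling_nth n w Hw q.
case/and5P => a b c /eqP d e.
case: (ltngtP j p) => jp; last by constructor 1.
  constructor 2; rewrite ltnNge; apply/negP => H.
  have [E|E] : j.+2 = p \/ j.+1 = p by lia.
    have := B j.+1; move: e; rewrite -E /=; do !case: ifP => ?; lia.
  have := B j; move: d; do !case: ifP => ?; lia.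
constructor 3; rewrite ltnNge; apply/negP => H.
have [E|E] : j = p.+2 \/ j = p.+1 by lia.
  have := B p; move: c; rewrite E ?subn2 /=; do !case: ifP => ?; lia.
have := B p; move: d; rewrite E ?subn2 /=; do !case: ifP => ?; lia.
Qed.

Lemma Mesa_insert2 v : p \notin mesa_zone (mesa_pos w) ->
  (v \in Mesa w') = (v \in Mesa w) || (0 < p < size w) && (v == n.+1).
Proof.
rewrite mem_mesa_zone !mem_mesa_pos !negb_or => /and3P[z0 z1 z2].
apply/MesaP/orP => [[j Hj <-]|].
  have [E|E|E] := mesa_at_insert2_inv Hj.
  - right; move: Hj; rewrite E mesa_at_insert2_eq => ->.
    by rewrite nth_insert2 ltnn ltnW //= eqxx.
  - left; apply/MesaP; exists j; first by rewrite -mesa_at_insert2_lt.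
    by rewrite nth_insert2; case: ifP => //; lia.
  - left; apply/MesaP; exists (j - 2).
      by rewrite -mesa_at_insert2_gt; [|lia]; congr (mesa_at _ _): Hj; lia.
    by rewrite nth_insert2; case: ifP; [lia|]; case: ifP; [lia|].
case=> [/MesaP[i Hi <-]|/andP[Hp0 /eqP ->]]; last first.
  exists p; first by rewrite mesa_at_insert2_eq.
  by rewrite nth_insert2 ltnn ltnW.
have [ip|ip] : i.+2 < p \/ p < i.
  case: (ltnP p i) => ip; first by right.
  left; rewrite ltnNge; apply/negP => ip2.
  have [E|[E|E]] : p = i \/ p = i.+1 \/ p = i.+2 by lia.
  - by rewrite E Hi in z0.
  - by rewrite E Hi in z1.
  - by rewrite E Hi in z2.
exists i; first by rewrite mesa_at_insert2_lt.
  by rewrite nth_insert2; case: ifP => //; lia.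
exists i.+2; first by rewrite mesa_at_insert2_gt.
by rewrite nth_insert2; case: ifP; [lia|]; case: ifP; [lia|]; rewrite subn2.
Qed.

End Insert.

(** * Admissible mesa sets *)

(** The induction builds words for the successive sets [M :&: {1, ..., n}]; this
    is why the inequality is required at every [i] and not only at [n]. *)
Lemma Stirling_of_count (M : {fset nat}) n :
  (forall i, 0 < i <= n -> 3 * count (mem M) (iota 1 i) < 2 * i) ->
  exists2 w, StirlingPerm n w &
    forall v, (v \in Mesa w) = (v \in M) && (0 < v <= n).
Proof.
elim: n => [_|n IHn HM].
  exists [::]; first by split.
  by move=> v; rewrite [RHS]andbC; case: v => [|v] /=; rewrite in_fset.
have [|w Hw Mw] := IHn; first by move=> i Hi; apply: HM; lia.
have szw := Stirling_size Hw.
suff [p [pw pz pM]] : exists p, [/\ p <= size w,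
    p \notin mesa_zone (mesa_pos w) & (0 < p < size w) = (n.+1 \in M)].
  exists (insert2 p n.+1 w); first exact: Stirling_insert2.
  move=> v; rewrite (Mesa_insert2 Hw) // Mw pM.
  case: eqP => [->|vn]; first by rewrite ltnn leqnn !andbF !andbT.
  by rewrite andbF orbF; congr andb; lia.
case nM: (n.+1 \in M); last first.
  (* At the end of the word, [n + 1] is no mesa, and no zone reaches so far. *)
  exists (size w); split; [by []| |by rewrite ltnn andbF].
  rewrite mem_mesa_zone !mem_mesa_pos; apply/negP.
  by case/or3P => [|/andP[h]|/andP[h]] /and5P[]; lia.
(* The inner positions outnumber the elements of the zones. *)
have sz_lt : size (mesa_zone (mesa_pos w)) < size (iota 1 (size w).-1).
  rewrite size_mesa_zone size_iota szw.
  have -> : size (mesa_pos w) = count (mem M) (iota 1 n).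
    rewrite -(@eq_in_count _ (mem (Mesa w))); last first.
      by move=> v; rewrite mem_iota /= Mw add1n ltnS => ->; rewrite andbT.
    rewrite (count_Mesa Hw (leqnn n)) -[LHS]count_predT; apply: eq_in_count => s.
    rewrite mem_mesa_pos => /and5P[_ ssz _ _ _] /=.
    by have := @Stirling_nth n w Hw s; lia.
  have := HM n.+1; rewrite iota1S count_cat /= nM; lia.
have /allPn[p] : ~~ all (mem (mesa_zone (mesa_pos w))) (iota 1 (size w).-1).
  apply/negP => /allP H; move: sz_lt; rewrite ltnNge => /negP; apply.
  exact: uniq_leq_size (iota_uniq _ _) H.
rewrite mem_iota => Hp pz; exists p; split=> //; lia.
Qed.

Lemma AMSP (n : nat) (M : {fset nat}) :
  AMS n M <-> {subset M <= iota 1 n} /\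
    forall i, 0 < i <= n -> 3 * count (mem M) (iota 1 i) < 2 * i.
Proof.
split=> [[w Hw <-]|[sM /Stirling_of_count[w Hw Mw]]].
  split; last by move=> i; apply: Mesa_count_lt.
  move=> v /MesaP[i /and5P[_ isz _ _ _] <-]; rewrite mem_iota.
  by have := @Stirling_nth n w Hw i; lia.
exists w => //; apply/fsetP => v; rewrite Mw.
case vM: (v \in M) => //=; have := sM v vM; rewrite mem_iota; lia.
Qed.

(** * Lattice paths *)

Definition is_north (s : step) : bool := if s is North then true else false.

Lemma endpoint_count (pi : seq step) :
  endpoint pi = (size pi - count is_north pi, count is_north pi).
Proof.
elim/last_ind: pi => // pi s IH.
rewrite /endpoint foldl_rcons -/(endpoint pi) IH size_rcons -cats1 count_cat.
have := count_size is_north pi.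
by case: s => /= le_north; congr pair; lia.
Qed.

Lemma count_take_delta n (M : {fset nat}) i : i <= n ->
  count is_north (take i (delta n M)) = count (mem M) (iota 1 i).
Proof.
move=> Hi; rewrite /delta -map_take take_iota (minn_idPl Hi) count_map.
by apply: eq_count => v /=; case: ifP.
Qed.

Lemma size_delta n M : size (delta n M) = n.
Proof. by rewrite size_map size_iota. Qed.

Lemma card_count n (M : {fset nat}) :
  {subset M <= iota 1 n} -> #|` M|%fset = count (mem M) (iota 1 n).
Proof.
move=> sM; rewrite -size_filter; apply/perm_size/uniq_perm => //.
  by rewrite filter_uniq ?iota_uniq.
by move=> v; rewrite mem_filter /=; case vM: (v \in M) => //=; rewrite sM.
Qed.

Lemma slope_ltE (m k x y : nat) : 0 < k ->
  ((y%:Q < m%:Q / k%:Q * x%:Q)%R : bool) = (k * y < m * x).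
Proof.
move=> k0; rewrite mulrAC ltr_pdivlMr ?ltr0z //.
by rewrite -!intrM ltr_int; lia.
Qed.

(** The right-hand side is the admissibility condition of [AMSP] read on the
    path; unlike the definition of a Dyck path, it includes the endpoint. *)
Lemma DyckPath_countP k (pi : seq step) : 0 < k ->
  DyckPath (2 * k - 1) k pi <->
  [/\ size pi = 3 * k - 1, count is_north pi = 2 * k - 1 &
      forall i, 0 < i <= 3 * k - 1 -> 3 * count is_north (take i pi) < 2 * i].
Proof.
move=> k0; have cs := count_size is_north.
(* With [N := 3 * k - 1], the left-hand side is [N * y < (2 * k - 1) * i], where
   [3 * (2 * k - 1) = 2 * N - 1].  Hence [3 * y + 1 <= 2 * i] gives
   [3 * N * y <= 3 * (2 * k - 1) * i + (i - N)], and [i < N]; the converse is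
   immediate. *)
have step i y : y <= i -> 0 < i < 3 * k - 1 ->
    (k * y < (2 * k - 1) * (i - y)) = (3 * y < 2 * i).
  move=> yi Hi; apply/idP/idP; nia.
rewrite /DyckPath /= endpoint_count; split=> [[[Ex Ey] H]|[sz cn H]].
  have sz : size pi = 3 * k - 1 by have := cs pi; lia.
  split=> // i /andP[i0]; rewrite leq_eqVlt => /orP[/eqP E|ilt].
    by rewrite take_oversize ?sz ?E // Ey; lia.
  have := H i i0; rewrite sz => /(_ ilt).
  rewrite endpoint_count size_takel ?sz ?(ltnW ilt) //= slope_ltE // step ?i0 //.
  by apply: leq_trans (cs _) _; rewrite size_take_min; lia.
rewrite sz cn; split=> [|i i0 ilt]; first by congr pair; lia.
rewrite endpoint_count size_takel ?sz ?(ltnW ilt) //= slope_ltE // step ?i0 //.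
  by apply: H; rewrite i0 ltnW.
by apply: leq_trans (cs _) _; rewrite size_take_min; lia.
Qed.

Definition north_set (pi : seq step) : {fset nat} :=
  [fset i in iota 1 (size pi) | is_north (nth East pi i.-1)]%fset.

Lemma mem_north_set pi i :
  (i \in north_set pi) = (i \in iota 1 (size pi)) && is_north (nth East pi i.-1).
Proof. by rewrite !inE. Qed.

Lemma north_setK pi : delta (size pi) (north_set pi) = pi.
Proof.
apply: (@eq_from_nth _ East); rewrite size_delta // => i Hi.
rewrite (nth_map 0) ?size_iota // nth_iota // mem_north_set mem_iota add1n.
by rewrite !ltnS Hi /=; case: (nth _ _ _).
Qed.

Lemma delta_inj n (M N : {fset nat}) :
  {subset M <= iota 1 n} -> {subset N <= iota 1 n} ->
  delta n M = delta n N -> M = N.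
Proof.
move=> sM sN E; apply/fsetP => v; case vn: (v \in iota 1 n); last first.
  by rewrite (contraFF (sM v) vn) (contraFF (sN v) vn).
have /eq_in_map/(_ v vn) := E.
by case: ifP; case: ifP.
Qed.

Theorem theorem4p9 (k : nat) (hk : (1 <= k)%N) :
  set_bij [set M : {fset nat} | AMS (3 * k - 1) M /\ #|` M|%fset = (2 * k - 1)%N]%classic
          (DyckPath (2 * k - 1) k)
          (delta (3 * k - 1)).
Proof.
have take_count M : count is_north (delta (3 * k - 1) M) =
    count (mem M) (iota 1 (3 * k - 1)).
  by rewrite -(@count_take_delta (3 * k - 1)) // take_oversize ?size_delta.
split.
- move=> M [/AMSP[sM HM] cM]; apply/DyckPath_countP => //.
  rewrite size_delta take_count -card_count //; split=> // i /andP[i0 Hi].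
  by rewrite count_take_delta // HM // i0.
- move=> M N /set_mem[/AMSP[sM _] _] /set_mem[/AMSP[sN _] _].
  exact: delta_inj.
- move=> pi /DyckPath_countP-/(_ hk)[sz cn H].
  have piK : delta (3 * k - 1) (north_set pi) = pi by rewrite -sz north_setK.
  have sN : {subset north_set pi <= iota 1 (3 * k - 1)}.
    by move=> i; rewrite mem_north_set sz => /andP[].
  exists (north_set pi) => //; split; last by rewrite (card_count sN) -take_count piK.
  apply/AMSP; split=> // i /andP[i0 Hi].
  by rewrite -(count_take_delta _ Hi) piK H // i0.
Qed.
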